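(* If $k$ is a power of $4$, then whenever $d$ is a positive integer with $d\equiv -k\pmod{k^2/2+k}$, \[\theta_\mathbb{R}(d,k)\leq\frac{\sqrt{k+4-\Omega(k^{-1/2})}}{d}.\] Additionally, for any fixed positive integer $k$, \[\theta_\mathbb{R}(d,k)\leq(1+o(1))\frac{2\sqrt{k+1}}{d},\] where $o(1)\to0$ as $d\to\infty$.
   Context: For positive integers $d,k$, $\theta_\mathbb{R}(d,k):=\min \max_{i\neq j}|\langle x_i,x_j\rangle|$ over all choices of $d+k$ unit vectors $x_1,\dots,x_{d+k}\in\mathbb{R}^d$. The term $\Omega(k^{-1/2})$ denotes a quantity that is at least $ck^{-1/2}$ for some absolute constant $c>0$ (independent of $k$ and $d$). *)

(* Defs.v *)
From HB Require Import structures.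
From mathcomp Require Import all_boot all_order all_algebra.
From mathcomp Require Import all_classical all_reals all_analysis.

Set Implicit Arguments.
Unset Strict Implicit.
Unset Printing Implicit Defensive.

Import Order.TTheory GRing.Theory Num.Theory.
Import numFieldNormedType.Exports.

Local Open Scope classical_set_scope.
Local Open Scope ring_scope.

Definition dot (R : realType) (d : nat) (u v : 'rV[R]_d) : R :=
  \sum_(l < d) u ord0 l * v ord0 l.

Definition unit_family (R : realType) (d n : nat) (x : 'I_n -> 'rV[R]_d) : Prop :=
  forall i, dot (x i) (x i) = 1.

(* The base value 0 of the maximum is harmless: the terms are nonnegative. *)
Definition coherence (R : realType) (d n : nat) (x : 'I_n -> 'rV[R]_d) : R :=
  \big[Num.max/0]_(p : 'I_n * 'I_n | p.1 != p.2) `|dot (x p.1) (x p.2)|.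

(* For 0 < d this infimum is attained, hence a minimum: see theta_min. *)
Definition theta (R : realType) (d k : nat) : R :=
  inf [set coherence x | x in @unit_family R d (d + k)].

(* The modulus k ^ 2 / 2 + k of the theorem is an integer for even k but not
   for k = 1 = 4 ^ 0, so congruence is taken among rationals: a - b is an
   integer multiple of m. *)
Definition congr_mod (a b m : rat) : Prop := exists j : int, a - b = j%:~R * m.

Lemma congr_modP (k d : nat) : ~~ odd k ->
  congr_mod d%:R (- k%:R) (k%:R ^+ 2 / 2 + k%:R) <->
  (k ^ 2 %/ 2 + k %| d + k)%N.
Proof.
move=> ek; have k2 : (k ^ 2 = 2 * (k ^ 2 %/ 2))%N.
  by rewrite mulnC divnK// dvdn2 oddX (negbTE ek).
have -> : k%:R ^+ 2 / 2 + k%:R = ((k ^ 2 %/ 2 + k)%N%:R : rat).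
  rewrite natrD; congr (_ + _).
  by rewrite -natrX [in LHS]k2 natrM mulrC mulKf.
rewrite /congr_mod opprK -natrD; split.
  move=> [j]; rewrite !pmulrn -intrM => /eqP.
  rewrite eqr_int => /eqP dj.
  suff : (Posz (k ^ 2 %/ 2 + k) %| Posz (d + k))%Z by rewrite dvdzE.
  by rewrite dj dvdz_mull.
by move=> /dvdnP[j ->]; exists (Posz j); rewrite natrM.
Qed.

Section attained.
Variables (R : realType) (d n : nat).

Let fam (z : 'rV[R]_(n * d)) (i : 'I_n) : 'rV[R]_d := row i (vec_mx z).

Let famE z i l : fam z i ord0 l = z ord0 (mxvec_index i l).
Proof. by rewrite /fam !mxE. Qed.

Let coord_fam_cont i l : continuous (fun z => fam z i ord0 l).
Proof.
have -> : (fun z => fam z i ord0 l) = (fun z => z ord0 (mxvec_index i l)).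
  by apply/funext => z; exact: famE.
exact: coord_continuous.
Qed.

Let dot_fam_cont i j : continuous (fun z => dot (fam z i) (fam z j)).
Proof.
rewrite /dot; apply: continuous_big => [|l _ z]; first exact: add_continuous.
exact: (cvgM (coord_fam_cont (i:=i) (l:=l) (x:=z))
             (coord_fam_cont (i:=j) (l:=l) (x:=z))).
Qed.

Let coherence_fam_cont : continuous (fun z => coherence (fam z)).
Proof.
rewrite /coherence; apply: continuous_big => [|p _] z.
  by apply: (@continuous_max R _ fst snd z); [exact: cvg_fst|exact: cvg_snd].
exact: (cvg_norm (dot_fam_cont (i:=p.1) (j:=p.2) (x:=z))).
Qed.

Lemma coherence_min : (0 < d)%N ->
  exists2 x, @unit_family R d n x &
    forall y, @unit_family R d n y -> coherence x <= coherence y.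
Proof.
move=> d0; pose A := [set z | unit_family (fam z)].
have famK (y : 'I_n -> 'rV[R]_d) : fam (mxvec (\matrix_i y i)) = y.
  by apply/funext => i; rewrite /fam mxvecK rowK.
have A0 : A !=set0.
  exists (mxvec (\matrix_i delta_mx ord0 (Ordinal d0))).
  rewrite /A/= famK => i; rewrite /dot (bigD1 (Ordinal d0))//= big1.
    by rewrite !mxE !eqxx mulr1 addr0.
  by move=> l /negbTE lN; rewrite !mxE lN andbF mulr0.
have cA : compact A.
  apply: bounded_closed_compact.
    exists 1; split => // M M1 z zA.
    rewrite /= [leLHS]/Num.norm/= mx_normrE; apply: bigmax_le => [|[i0 q] _ /=].
      by rewrite (le_trans ler01)// ltW.
    rewrite (ord1 i0); case/mxvec_indexP: q => i l.
    rewrite -famE; apply: le_trans (ltW M1).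
    rewrite -(@ler_pXn2r _ 2)// ?nnegrE// expr1n real_normK ?num_real//.
    rewrite -(zA i) /dot (bigD1 l)//= -expr2 lerDl sumr_ge0// => m _.
    by rewrite -expr2 sqr_ge0.
  have -> : A = \bigcap_(i in setT) [set z | dot (fam z i) (fam z i) = 1].
    by apply/seteqP; split => [z zA i _|z zA i]; [exact: zA|exact: (zA i)].
  apply: closed_bigI => i _.
  apply: (@preimage_closed _ _ (fun z => dot (fam z i) (fam z i)) [set x | x = 1]).
    by move=> z _; exact: dot_fam_cont.
  exact: closed_eq.
have [c] := compact_EVT_min A0 cA (continuous_subspaceT coherence_fam_cont).
rewrite inE => Ac cmin; exists (fam c) => // y yu.
by have := cmin (mxvec (\matrix_i y i)); rewrite !famK; apply; rewrite inE /A/= famK.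
Qed.

End attained.

Lemma theta_min (R : realType) (d k : nat) : (0 < d)%N ->
  (exists2 x, @unit_family R d (d + k) x & coherence x = theta R d k) /\
  (forall y, @unit_family R d (d + k) y -> theta R d k <= coherence y).
Proof.
move=> d0; have [x xu xmin] := @coherence_min R d (d + k) d0.
suff tx : coherence x = theta R d k.
  by split=> [|y yu]; [exists x|rewrite -tx; exact: xmin].
apply/eqP; rewrite eq_le; apply/andP; split.
  apply: lb_le_inf; first by exists (coherence x), x.
  by move=> _ [y yu <-]; exact: xmin.
apply: ge_inf; last by exists x.
by exists (coherence x) => _ [y yu <-]; exact: xmin.
Qed.

(* Main.v *)
(** Vectors x_1, ..., x_n in R^d, n = d + k, amount to a positive semidefinite
n x n Gram matrix of rank at most d. Let k = q^2 with q = 2^(h+1). A Kerdock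
set of k/2 quadratic forms on F_2^(2h+2) (the forms differ pairwise by a form
with nondegenerate polarization) gives k/2 + 1 real mutually unbiased bases of
R^k, hence N = k (k/2 + 1) vectors. Let G be their Gram matrix; off the
diagonal the entries of q G - (q - 1) 1 are 0 or +-1. Repeating each vector t
times, with N t = d + k, and writing S for the resulting n x n matrix, S has
top eigenvalue (q^3/2 + 1) t, attained on the row space of the k x n matrix of
vectors; so with e = ((q^3/2 + 1) t - 1)^-1 the matrix (1 + e) 1 - e S is
positive semidefinite, of rank d, with unit diagonal and off-diagonal entries at
most e in absolute value. Elementary estimates give e <= sqrt (k + 4 - 1/q) / d.

For arbitrary k take the power K of 4 with k < K <= 4 k; then
K + 4 <= 4 (k + 1), and a configuration for K in a dimension d - O(1) of the
right residue class is completed by orthogonal unit vectors. *)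

Require Import Defs.
From mathcomp Require Import all_boot all_order all_algebra all_field.
From mathcomp Require Import ring lra zify.
From mathcomp Require Import all_classical all_reals all_analysis.

Set Implicit Arguments.
Unset Strict Implicit.
Unset Printing Implicit Defensive.

Import Order.TTheory GRing.Theory Num.Theory.
Import numFieldNormedType.Exports.

Local Open Scope classical_set_scope.
Local Open Scope ring_scope.

(** * Positive semidefinite matrices and their Gram factorization *)

Definition psd (R : rcfType) (n : nat) (M : 'M[R]_n) : Prop :=
  M^T = M /\ forall x : 'rV_n, 0 <= (x *m M *m x^T) ord0 ord0.

Lemma qform_delta (R : rcfType) (n : nat) (M : 'M[R]_n) (i j : 'I_n) :
  ((delta_mx ord0 i : 'rV_n) *m M *m (delta_mx ord0 j : 'rV_n)^T) ord0 ord0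
    = M i j.
Proof. by rewrite trmx_delta -rowE -colE !mxE. Qed.

Lemma qformB (R : rcfType) (n : nat) (M : 'M[R]_n) (a : R) (x y : 'rV_n) :
  M^T = M ->
  ((x - a *: y) *m M *m (x - a *: y)^T) ord0 ord0 =
  (x *m M *m x^T) ord0 ord0 - 2 * a * (x *m M *m y^T) ord0 ord0
    + a ^+ 2 * (y *m M *m y^T) ord0 ord0.
Proof.
move=> Ms; have yx : (y *m M *m x^T) ord0 ord0 = (x *m M *m y^T) ord0 ord0.
  by rewrite -[in RHS]Ms -[x in RHS]trmxK -!trmx_mul mulmxA [RHS]mxE.
have -> : (x - a *: y)^T = x^T - a *: y^T by rewrite linearB linearZ.
rewrite !mulmxBl !mulmxBr.
rewrite -!scalemxAl -!scalemxAr scalerA.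
have e (A B : 'M[R]_1) : (A - B) ord0 ord0 = A ord0 ord0 - B ord0 ord0.
  by rewrite !mxE.
have s b (A : 'M[R]_1) : (b *: A) ord0 ord0 = b * A ord0 ord0 by rewrite mxE.
rewrite !e !s yx; ring.
Qed.

(** With zero diagonal, the form at [e_i - M i j e_j] equals [-2 (M i j)^2], which can only be
    nonnegative if [M i j = 0]. *)
Lemma psd_diag_eq0 (R : rcfType) (n : nat) (M : 'M[R]_n) :
  psd M -> (forall i, M i i = 0) -> M = 0.
Proof.
move=> [Ms Mp] M0; apply/matrixP => i j; rewrite mxE; apply/eqP.
have := Mp (delta_mx ord0 i - M i j *: delta_mx ord0 j).
rewrite qformB // !qform_delta !M0 -sqrf_eq0 eq_le sqr_ge0 andbT.
by nra.
Qed.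

(** One step of symmetric elimination. The form of the Schur complement at [x] is the minimum of the
    form of [M] along the line [x - a e_i], so positivity survives. *)
Lemma psd_schur (R : rcfType) (n : nat) (M : 'M[R]_n) (i : 'I_n) :
  psd M -> M i i != 0 ->
  let M' := M - (M i i)^-1 *: (col i M *m row i M) in
  psd M' /\ (\rank M' < \rank M)%N.
Proof.
move=> [Ms Mp] Mi0 M'; have cr : (col i M)^T = row i M by rewrite tr_col Ms.
split; first split.
- have -> : M'^T = M^T - (M i i)^-1 *: (col i M *m row i M)^T.
    by rewrite linearB linearZ.
  by rewrite trmx_mul cr -{1}cr trmxK Ms.
(* The coefficient [b / M i i] is the minimizer along [x - a e_i]. *)
- move=> x; set b := (x *m M *m (delta_mx ord0 i : 'rV_n)^T) ord0 ord0.
  have := Mp (x - (b / M i i) *: delta_mx ord0 i).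
  rewrite qformB // qform_delta -/b.
  suff -> : (x *m M' *m x^T) ord0 ord0 =
      (x *m M *m x^T) ord0 ord0 - 2 * (b / M i i) * b
        + (b / M i i) ^+ 2 * M i i.
    by [].
  rewrite /M' mulmxBr mulmxBl -scalemxAr -scalemxAl [LHS]mxE [X in _ + X]mxE.
  rewrite [X in - X]mxE mulmxA -(mulmxA (x *m col i M)).
  have -> : row i M *m x^T = (x *m col i M)^T by rewrite trmx_mul cr.
  have -> : x *m col i M = b%:M.
    by rewrite colE mulmxA [LHS]mx11_scalar /b trmx_delta.
  rewrite tr_scalar_mx -scalar_mxM [X in _ * X]mxE /= mulr1n.
  by set q := (x *m M *m x^T) _ _; field.
(* The rank drops because the kernel grows strictly: it keeps [kermx M] and gains [e_i], which [M]
   does not kill since [M i i != 0]. *)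
have kk : (kermx M <= kermx M')%MS.
  apply/sub_kermxP; rewrite /M' mulmxBr -scalemxAr colE !mulmxA.
  by rewrite mulmx_ker !mul0mx scaler0 subr0.
have dk : ((delta_mx ord0 i : 'rV_n) <= kermx M')%MS.
  apply/sub_kermxP; rewrite /M' mulmxBr -scalemxAr mulmxA -!rowE.
  have -> : row i (col i M) = (M i i)%:M.
    by rewrite [LHS]mx11_scalar !mxE.
  by rewrite mul_scalar_mx scalerA mulVf // scale1r subrr.
have dN : ~~ ((delta_mx ord0 i : 'rV_n) <= kermx M)%MS.
  apply/negP => /sub_kermxP; rewrite -rowE => /matrixP/(_ ord0 i).
  by rewrite !mxE => /eqP; apply/negP.
have : (kermx M < kermx M')%MS.
  by rewrite ltmxE kk /=; apply: contra dN => /(submx_trans dk).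
move=> /rank_ltmx; rewrite !mxrank_ker.
by have := rank_leq_row M'; have := rank_leq_row M; lia.
Qed.

(** Cholesky factorization by induction on the rank bound: each Schur step contributes one column,
    scaled by the square root of its pivot. *)
Lemma psd_factor (R : rcfType) (n r : nat) (M : 'M[R]_n) :
  psd M -> (\rank M <= r)%N -> exists X : 'M[R]_(n, r), M = X *m X^T.
Proof.
elim: r M => [|r IHr] M Mp rM.
  exists 0; rewrite mul0mx; apply/eqP; by rewrite -mxrank_eq0 -leqn0.
case: (pickP (fun i => M i i != 0)) => [i Mi0|M0]; last first.
  exists 0; rewrite mul0mx; apply: (psd_diag_eq0 Mp) => i.
  exact/eqP/negbFE/M0.
have [M'p rM'] := psd_schur Mp Mi0.
have [X XE] := IHr _ M'p (leq_trans rM' rM).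
have Mii : 0 < M i i.
  by rewrite lt0r Mi0 /= -(qform_delta M); exact: Mp.2.
pose c := (Num.sqrt (M i i))^-1 *: col i M.
have YE : row_mx c X *m (row_mx c X)^T = M.
  rewrite tr_row_mx mul_row_col -XE /c.
  have -> : ((Num.sqrt (M i i))^-1 *: col i M)^T =
      (Num.sqrt (M i i))^-1 *: row i M by rewrite linearZ /= tr_col Mp.1.
  rewrite -scalemxAl -scalemxAr scalerA -invfM -expr2 sqr_sqrtr ?ltW //.
  by rewrite addrC subrK.
by exists (row_mx c X).
Qed.

Lemma psd_comb (R : rcfType) (n : nat) (a b : R) (A B : 'M[R]_n) :
  0 <= a -> 0 <= b -> psd A -> psd B -> psd (a *: A + b *: B).
Proof.
move=> a0 b0 [As Ap] [Bs Bp]; split; first by rewrite linearD !linearZ /= As Bs.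
move=> x; rewrite mulmxDr mulmxDl -!scalemxAr -!scalemxAl.
rewrite mxE [X in X + _]mxE [X in _ + X]mxE.
by rewrite addr_ge0 // mulr_ge0.
Qed.

(** Here [c x A x^T] is the squared norm of [x A]. It serves for multiples of orthogonal
    projections. *)
Lemma psd_mul_self (R : rcfType) (n : nat) (c : R) (A : 'M[R]_n) :
  0 < c -> A^T = A -> A *m A = c *: A -> psd A.
Proof.
move=> c0 As AA; split=> // x.
rewrite -(pmulr_rge0 _ c0).
have -> : c * (x *m A *m x^T) ord0 ord0 = ((x *m A) *m (x *m A)^T) ord0 ord0.
  rewrite trmx_mul As mulmxA -(mulmxA x A A) AA -scalemxAr -scalemxAl.
  by rewrite [RHS]mxE.
by rewrite mxE sumr_ge0 // => j _; rewrite [X in _ * X]mxE -expr2 sqr_ge0.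
Qed.

(** * Low-rank Gram matrices from tight frames *)

(* With [P] the orthogonal projection onto the column space of [W], the Gram
   matrix is [(1 + e) (1 - P) + e (q - 1) (E - t P)]; the value of [e] is the
   one for which this equals [(1 + e) 1 - e (q W W^T - (q - 1) E)]. *)
Lemma frame_gram (R : rcfType) (n K : nat) (q t : R) (W : 'M[R]_(n, K))
    (E : 'M[R]_n) (D := q * n%:R / K%:R - (q - 1) * t - 1) :
  (0 < n)%N -> (0 < K)%N -> 0 < t -> 1 <= q -> 0 < D ->
  W^T *m W = (n%:R / K%:R)%:M -> E^T = E -> E *m E = t *: E ->
  E *m W = t *: W -> (forall i, (W *m W^T) i i = 1) -> (forall i, E i i = 1) ->
  (forall i j, i != j -> `|q * (W *m W^T) i j - (q - 1) * E i j| <= 1) ->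
  exists X : 'M[R]_(n, n - K), (forall i, (X *m X^T) i i = 1) /\
    forall i j, i != j -> `|(X *m X^T) i j| <= D^-1.
Proof.
move=> n0 K0 t0 q1 D0 WW Es EE EW Wd Ed off.
have nR : n%:R != 0 :> R by rewrite pnatr_eq0 -lt0n.
have KR : K%:R != 0 :> R by rewrite pnatr_eq0 -lt0n.
pose e := D^-1; have e0 : 0 < e by rewrite invr_gt0.
pose p : R := K%:R / n%:R.
have p0 : p != 0 by rewrite mulf_neq0 ?invr_eq0.
pose P := p *: (W *m W^T).
have Ps : P^T = P by rewrite /P linearZ /= trmx_mul trmxK.
have PW : P *m W = W.
  rewrite /P -scalemxAl -mulmxA WW mul_mx_scalar scalerA /p.
  by rewrite mulrA divfK // divff // scale1r.
have PP : P *m P = P by rewrite {2}/P -scalemxAr mulmxA PW.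
have EP : E *m P = t *: P.
  by rewrite /P -scalemxAr mulmxA EW -scalemxAl !scalerA mulrC.
have PE : P *m E = t *: P.
  by rewrite -[P in LHS]Ps -[E in LHS]Es -trmx_mul EP linearZ /= Ps.
have PD : P = p *: (W *m W^T) by [].
(* Both summands of [M] are nonnegative multiples of psd matrices: [P] is a projection, and
   [E - t P] squares to [t] times itself. *)
clearbody P; pose M := (1 + e) *: (1%:M - P) + (e * (q - 1)) *: (E - t *: P).
have Mp : psd M.
  apply: psd_comb; first by rewrite addr_ge0 ?ler01 ?(ltW e0).
  - by rewrite mulr_ge0 ?subr_ge0 ?(ltW e0).
  - apply: (@psd_mul_self _ _ 1) => //.
      by rewrite linearB /= trmx1 Ps.
    by rewrite mulmxBl mul1mx mulmxBr mulmx1 PP subrr subr0 scale1r.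
  - apply: (@psd_mul_self _ _ t) => //.
      by rewrite linearB linearZ /= Es Ps.
    rewrite mulmxBl !mulmxBr -!scalemxAl -!scalemxAr EE EP PE PP.
    by rewrite subrr subr0 scalerBr.
have MW : M *m W = 0.
  rewrite /M mulmxDl -!scalemxAl !mulmxBl -scalemxAl mul1mx EW PW.
  by rewrite !subrr !scaler0 addr0.
(* The [K] columns of [W] are independent and [M] annihilates them. *)
have rM : (\rank M <= n - K)%N.
  have WM : (W^T <= kermx M)%MS.
    by apply/sub_kermxP; rewrite -[M]Mp.1 -trmx_mul MW trmx0.
  have rW : (K <= \rank W^T)%N.
    apply: leq_trans (mxrankM_maxl W^T W); rewrite WW mxrank_unit //.
    by rewrite unitmxE det_scalar unitrX // unitfE mulf_neq0 ?invr_eq0.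
  have := leq_trans rW (mxrankS WM); rewrite mxrank_ker.
  by have := rank_leq_row M; lia.
have [X XE] := psd_factor Mp rM; exists X; rewrite -XE.
have De : e * D = 1 by rewrite mulVf // gt_eqF.
have ME i j : M i j =
    (1 + e) * (i == j)%:R - e * (q * (W *m W^T) i j - (q - 1) * E i j).
  have -> : M i j = (1 + e) * ((i == j)%:R - p * (W *m W^T) i j)
     + e * (q - 1) * (E i j - t * (p * (W *m W^T) i j)).
    by rewrite /M PD; move: (W *m W^T) => G; rewrite !mxE.
  (* This identity fixes [D]: it makes the coefficient of [W *m W^T] in [M] equal to [- e q]. *)
  have -> : (1 + e) = e * (q / p - (q - 1) * t).
    have -> : q / p - (q - 1) * t = D + 1.
      by rewrite /D /p invfM invrK; ring.
    by rewrite mulrDr De mulr1 addrC.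
  by move: (_ i j) (E i j) (_%:R) => g x b; field.
split=> [i|i j ij].
  by rewrite ME eqxx Wd Ed !mulr1 subKr mulr1 addrK.
rewrite ME (negbTE ij) mulr0 sub0r normrN normrM (gtr0_norm e0).
by apply: ler_piMr (off _ _ ij); exact: ltW.
Qed.

(** * Trace and a quadratic form on the field with [2^(2h+1)] elements *)

Section BinaryTrace.

Variables (F : finFieldType) (h : nat).
Hypothesis charF : 2%N \in [pchar F].
Hypothesis cardF : #|F| = (2 ^ (2 * h).+1)%N.

Lemma frob2D (i : nat) (x y : F) :
  (x + y) ^+ (2 ^ i) = x ^+ (2 ^ i) + y ^+ (2 ^ i).
Proof. by apply: exprDn_pchar; rewrite pnatX pnatE ?charF. Qed.

(** The absolute trace, kept inside [F]: its values lie in the prime field, and [tr] below reads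
    them as Booleans. *)
Definition ftr (x : F) : F := \sum_(i < (2 * h).+1) x ^+ (2 ^ i).

Lemma ftrD (x y : F) : ftr (x + y) = ftr x + ftr y.
Proof. by rewrite /ftr -big_split; apply: eq_bigr => i _; exact: frob2D. Qed.

Lemma ftr0 : ftr 0 = 0.
Proof. by apply: (addrI (ftr 0)); rewrite -ftrD !addr0. Qed.

Lemma ftr_sqr (x : F) : ftr (x ^+ 2) = ftr x.
Proof.
have shift i : (x ^+ 2) ^+ (2 ^ i) = x ^+ (2 ^ i.+1) by rewrite -exprM expnS.
rewrite /ftr big_ord_recr [RHS]big_ord_recl /= shift -cardF expf_card.
rewrite expn0 expr1 addrC; congr (_ + _).
by apply: eq_bigr => i _; rewrite shift.
Qed.

Lemma ftr_frob (i : nat) (x : F) : ftr (x ^+ (2 ^ i)) = ftr x.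
Proof. by elim: i => [|i IHi]; rewrite ?expr1 // expnSr exprM ftr_sqr. Qed.

Lemma sqr_sum_pchar2 (n : nat) (f : 'I_n -> F) :
  (\sum_i f i) ^+ 2 = \sum_i f i ^+ 2.
Proof.
apply: (big_morph (fun x : F => x ^+ 2)) => [x y|]; last by rewrite expr0n.
exact: (frob2D 1).
Qed.

Lemma ftr_idem (x : F) : ftr x ^+ 2 = ftr x.
Proof.
rewrite -[RHS]ftr_sqr /ftr sqr_sum_pchar2; apply: eq_bigr => i _.
by rewrite -!exprM mulnC.
Qed.

Lemma idemP (c : F) : c ^+ 2 = c -> c = (c != 0)%:R.
Proof.
move=> /eqP; rewrite -subr_eq0 expr2 -[X in _ - X]mulr1 -mulrBr.
rewrite mulf_eq0 subr_eq0.
by case: eqVneq => [->|] //= _ /eqP.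
Qed.

Lemma ftrZ (c x : F) : c ^+ 2 = c -> ftr (c * x) = c * ftr x.
Proof. by move=> /idemP ->; case: (c != 0); rewrite ?mul1r // !mul0r ftr0. Qed.

(** The degree [2h+1] is odd, so an odd number of ones is summed in characteristic 2. *)
Lemma ftr1 : ftr 1 = 1.
Proof.
rewrite /ftr (eq_bigr (fun _ => 1)) => [|i _]; last by rewrite expr1n.
rewrite sumr_const card_ord mulrS mulrnA.
by rewrite (mulrn_pchar charF) mul0rn addr0.
Qed.

(** This is the second elementary symmetric polynomial in the conjugates of [x]: since their number
    [2h+1] is odd, the unordered pairs split under Frobenius into [h] full orbits, one for each
    cyclic distance [i.+1]. *)
Definition fquad (x : F) : F := \sum_(i < h) ftr (x * x ^+ (2 ^ i.+1)).

Lemma fquad_idem (x : F) : fquad x ^+ 2 = fquad x.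
Proof.
by rewrite sqr_sum_pchar2; apply: eq_bigr => i _; exact: ftr_idem.
Qed.

(** The cross terms are the [g i] for [1 <= i <= 2h]: half of them appear directly, and Frobenius
    turns the other half into this shape. Adding [g 0], the trace of [x y], completes the sum to
    [ftr x * ftr y]. *)
Lemma fquadD (x y : F) :
  fquad (x + y) = fquad x + fquad y + (ftr (x * y) + ftr x * ftr y).
Proof.
pose g i := ftr (x * y ^+ (2 ^ i)).
have flip (i : nat) : (i <= (2 * h).+1)%N ->
    ftr (y * x ^+ (2 ^ i)) = g ((2 * h).+1 - i)%N.
  move=> ir; rewrite -(ftr_frob ((2 * h).+1 - i)) exprMn -exprM -expnD.
  by rewrite subnKC // -cardF expf_card mulrC.
have -> : fquad (x + y) = fquad x + fquad y +
    (\sum_(i < h) g i.+1 + \sum_(i < h) ftr (y * x ^+ (2 ^ i.+1))).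
  rewrite /fquad -!big_split /=; apply: eq_bigr => i _.
  rewrite frob2D mulrDl !mulrDr !ftrD -/(g _); ring.
congr (_ + _).
have -> : \sum_(i < h) ftr (y * x ^+ (2 ^ i.+1)) = \sum_(i < h) g (h + i).+1.
  rewrite (reindex_inj rev_ord_inj); apply: eq_bigr => i _ /=.
  rewrite flip; last by have := ltn_ord i; lia.
  by congr g; have := ltn_ord i; lia.
have -> : \sum_(i < h) g i.+1 + \sum_(i < h) g (h + i).+1 =
    \sum_(i < 2 * h) g i.+1.
  by rewrite mul2n -addnn big_split_ord.
(* The factor [ftr x] is 0 or 1, as is [ftr y], so one trace can be moved inside the other and
   expanded. *)
have gE : ftr x * ftr y = g 0%N + \sum_(i < 2 * h) g i.+1.
  rewrite mulrC -ftrZ ?ftr_idem // mulrC {2}/ftr mulr_sumr.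
  rewrite (big_morph ftr ftrD ftr0) big_ord_recl; congr (_ + _).
by rewrite gE addrA /g expr1 addrr_pchar2 // add0r.
Qed.

Definition tr (x : F) : bool := ftr x != 0.
Definition quad (x : F) : bool := fquad x != 0.

Lemma pchar2_addb (b c : bool) : (b%:R + c%:R : F) = (b (+) c)%:R.
Proof. by case: b; case: c; rewrite ?add0r ?addr0 ?addrr_pchar2. Qed.

Lemma natb_inj (b c : bool) : b%:R = c%:R :> F -> b = c.
Proof.
case: b c => [] [] // /eqP; first by rewrite oner_eq0.
by rewrite eq_sym oner_eq0.
Qed.

Lemma ftrE (x : F) : ftr x = (tr x)%:R.
Proof. exact/idemP/ftr_idem. Qed.

Lemma trD (x y : F) : tr (x + y) = tr x (+) tr y.
Proof. by apply: natb_inj; rewrite -pchar2_addb -!ftrE ftrD. Qed.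

Lemma tr_natb (b : bool) : tr b%:R = b.
Proof. by apply: natb_inj; rewrite -ftrE; case: b; rewrite ?ftr1 ?ftr0. Qed.

Lemma quadD (x y : F) :
  quad (x + y) = quad x (+) quad y (+) (tr (x * y) (+) (tr x && tr y)).
Proof.
apply: natb_inj; rewrite -!pchar2_addb -mulnb natrM -!ftrE.
by rewrite -!(idemP (fquad_idem _)) fquadD.
Qed.

Lemma tr_natbM (b : bool) (x : F) : tr (b%:R * x) = b && tr x.
Proof. by case: b; rewrite ?mul1r // mul0r (tr_natb false). Qed.

(** * Kerdock forms on the binary space [F * bool] of dimension [2h+2] *)

Definition pairing (u w : F * bool) : bool := tr (u.1 * w.1) (+) (u.2 && w.2).

Definition vadd (u w : F * bool) : F * bool := (u.1 + w.1, u.2 (+) w.2).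

Lemma pairingDr (w u z : F * bool) :
  pairing w (vadd u z) = pairing w u (+) pairing w z.
Proof. by rewrite /pairing mulrDr trD andb_addr addbACA. Qed.

Lemma pairingDl (w u z : F * bool) :
  pairing (vadd u z) w = pairing u w (+) pairing z w.
Proof. by rewrite /pairing mulrDl trD andb_addl addbACA. Qed.

Lemma pairingC (u w : F * bool) : pairing u w = pairing w u.
Proof. by rewrite /pairing mulrC andbC. Qed.

Lemma vaddC (u w : F * bool) : vadd u w = vadd w u.
Proof. by rewrite /vadd addrC addbC. Qed.

Lemma vaddK (z : F * bool) : involutive (fun u => vadd u z).
Proof.
by case: z => z b [x c]; rewrite /vadd /= -addrA addrr_pchar2 // addr0 addbK.
Qed.

Lemma vadd_eq0 (u w : F * bool) : (vadd u w == (0, false)) = (u == w).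
Proof.
case: u w => [x b] [y c]; rewrite /vadd !xpair_eqE /= -{1}(oppr_pchar2 charF y).
by rewrite subr_eq0; case: b; case: c.
Qed.

Lemma trV (c : F) : c != 0 -> tr (c * c^-1).
Proof. by move=> c0; rewrite divff // (tr_natb true). Qed.

Lemma pairing_nondeg (w : F * bool) :
  w != (0, false) -> exists z, pairing w z.
Proof.
case: w => x b; rewrite xpair_eqE negb_and.
case: (eqVneq x 0) => [-> /= b1|x0 _]; last first.
  by exists (x^-1, false); rewrite /pairing /= trV // andbF.
exists (0, true); rewrite /pairing /= mulr0 (tr_natb false) andbT.
by case: b b1.
Qed.

(** The Kerdock set is indexed by all [a] in [F], with [a = 0] giving the zero form; [kform a] below
    is the polarization of [kerdock a]. *)
Definition kerdock (a : F) (u : F * bool) : bool :=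
  quad (a * u.1) (+) (u.2 && tr (a * u.1)).

Definition kform (a : F) (u w : F * bool) : bool :=
  tr (a * u.1 * (a * w.1)) (+) (tr (a * u.1) && tr (a * w.1))
    (+) ((u.2 && tr (a * w.1)) (+) (w.2 && tr (a * u.1))).

Lemma kerdockD (a : F) (u w : F * bool) :
  kerdock a (vadd u w) = kerdock a u (+) kerdock a w (+) kform a u w.
Proof.
rewrite /kerdock /kform /= mulrDr quadD trD.
by do 2!case: (quad _); do 3!case: (tr _); case: u.2; case: w.2.
Qed.

Lemma kformDl (a : F) (u w z : F * bool) :
  kform a (vadd u z) w = kform a u w (+) kform a z w.
Proof.
rewrite /kform /= !mulrDr !mulrDl !trD.
by do 5!case: (tr _); case: u.2; case: w.2; case: z.2.
Qed.

(* If [(x, s)] lies in the radical, then [(a + b) x] is [0] or [1] and has trace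
   [0]; it is [0] because [1] has trace [1] in odd degree. *)
Lemma kform_nondeg (a b : F) (w : F * bool) :
  a != b -> w != (0, false) -> exists z, kform a z w (+) kform b z w.
Proof.
case: w => x s ab; rewrite xpair_eqE negb_and => w0.
have ab0 : a + b != 0 by rewrite -{1}(oppr_pchar2 charF b) subr_eq0.
(* Testing against [(0, true)] detects a difference between the traces of [a x] and [b x]; from then
   on they may be taken equal. *)
have [tx|tx] := boolP (tr (a * x) (+) tr (b * x)).
  exists (0, true); rewrite /kform /= !mulr0 !mul0r (tr_natb false).
  by move: tx; do 2!case: (tr _); case: (s).
have {tx}txE : tr (b * x) = tr (a * x) by move: tx; do 2!case: (tr _).
(* With equal traces, pairing with [(y, false)] is the functional [tr (c * y)], nonzero at [c^-1]
   unless [c = 0]. *)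
pose t := tr (a * x) (+) s.
pose c := (a + b) * ((a + b) * x + t%:R).
have formE y :
    kform a (y, false) (x, s) (+) kform b (y, false) (x, s) = tr (c * y).
  have -> : c * y = a * y * (a * x) + b * y * (b * x)
      + (t%:R * (a * y) + t%:R * (b * y)) + (a * b * x * y + a * b * x * y).
    by rewrite /c; ring.
  rewrite addrr_pchar2 // addr0 !trD !tr_natbM /kform /= txE /t.
  by do 5!case: (tr _); case: (s).
have [c0|c0] := eqVneq c 0; last first.
  by exists (c^-1, false); rewrite formE trV.
move/eqP: c0; rewrite mulf_eq0 (negbTE ab0) /= addr_eq0.
rewrite oppr_pchar2 // => /eqP ax.
have t0 : t = false.
  rewrite -[LHS]tr_natb -ax mulrDl trD txE; exact: addbb.
move: ax; rewrite t0 => /eqP; rewrite mulf_eq0 (negbTE ab0) /= => /eqP x0.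
move: w0 t0; rewrite /t x0 eqxx mulr0 (tr_natb false) /=.
by case: (s).
Qed.

(** * Character sums and mutually unbiased bases *)

Variable R : rcfType.

(** Translation by [z] permutes the terms and flips every sign, so the sum is its own negative. *)
Lemma sum_sign_eq0 (f : F * bool -> bool) (z : F * bool) :
  (forall u, f (vadd u z) = ~~ f u) -> \sum_u (-1) ^+ f u = 0 :> R.
Proof.
move=> fz; set S := \sum_u _.
have : S = - S.
  rewrite {1}/S (reindex_inj (inv_inj (vaddK z))) -sumrN.
  by apply: eq_bigr => u _; rewrite fz signrN.
by lra.
Qed.

Lemma pairing_orth (w w' : F * bool) :
  \sum_u (-1) ^+ (pairing w u (+) pairing w' u) =
  (#|{: F * bool}| * (w == w'))%:R :> R.
Proof.
under eq_bigr do rewrite -pairingDl.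
rewrite -vadd_eq0; have [->|ww] := eqVneq (vadd w w') (0, false).
  rewrite muln1 (eq_bigr (fun _ => 1)) => [|u _]; first by rewrite sumr_const.
  by rewrite /pairing mul0r (tr_natb false).
have [z wz] := pairing_nondeg ww; rewrite muln0.
by apply: (sum_sign_eq0 (z := z)) => u; rewrite pairingDr wz addbT.
Qed.

(** After squaring and translating one variable, the sum over [w] carries the inner character sum of
    [B _ w], which vanishes by nondegeneracy except at [w = 0]. *)
Lemma gauss_sum_sqr (g : F * bool -> bool) (B : F * bool -> F * bool -> bool) :
  (forall u w, g (vadd u w) = g u (+) g w (+) B u w) ->
  (forall u z w, B (vadd u z) w = B u w (+) B z w) ->
  (forall w, w != (0, false) -> exists z, B z w) ->
  (\sum_u (-1) ^+ g u) ^+ 2 = #|{: F * bool}|%:R :> R.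
Proof.
move=> gD BD Bnd.
have -> : (\sum_u (-1) ^+ g u) ^+ 2 =
    \sum_w (-1) ^+ g w * \sum_u (-1) ^+ B u w :> R.
  rewrite expr2 mulr_sumr.
  have -> : \sum_w (-1) ^+ g w * \sum_u (-1) ^+ B u w =
      \sum_u \sum_w (-1) ^+ g w * (-1) ^+ B u w :> R.
    by rewrite exchange_big; apply: eq_bigr => w _; rewrite mulr_sumr.
  rewrite -mulr_sumr mulr_suml; apply: eq_bigr => u _.
  rewrite mulr_sumr (reindex_inj (inv_inj (vaddK u))).
  apply: eq_bigr => w _; rewrite vaddC gD -!signr_addb; congr (_ ^+ _).
  by rewrite -addbA addKb.
have g0 : g (0, false) = false.
  have B0 w : B (0, false) w = false.
    have := BD (0, false) (0, false) w; rewrite /vadd /= addr0.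
    by case: (B _ _).
  have := gD (0, false) (0, false).
  by rewrite B0 /vadd /= addr0; case: (g _).
rewrite (bigD1 (0, false)) //= [X in _ + X]big1 => [|w w0]; last first.
  have [z zw] := Bnd _ w0.
  by rewrite (sum_sign_eq0 (z := z)) ?mulr0 // => u; rewrite BD zw addbT.
rewrite addr0 g0 mul1r (eq_bigr (fun _ => 1)) => [|u _].
  by rewrite sumr_const.
have := gD u (0, false).
rewrite g0 addbF /vadd /= addr0 addbF -surjective_pairing.
by case: (g u); case: (B _ _).
Qed.

Let r : R := (2 ^ h.+1)%:R.

Lemma sqr_root_card : r ^+ 2 = #|{: F * bool}|%:R.
Proof.
rewrite card_prod card_bool cardF /r -natrX -expnM muln2 -expnSr.
by congr (_%:R); congr expn; lia.
Qed.

Lemma root_card_neq0 : r != 0.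
Proof. by rewrite pnatr_eq0 expn_eq0. Qed.

(* [None] stands for the standard basis. *)
Definition mub (b : option F) (v u : F * bool) : R :=
  if b is Some a then (-1) ^+ (kerdock a u (+) pairing v u) / r
  else (v == u)%:R.

Lemma mub_orth (b : option F) (v v' : F * bool) :
  \sum_u mub b v u * mub b v' u = (v == v')%:R.
Proof.
case: b => [a|] /=; last first.
  rewrite (bigD1 v) //= eqxx mul1r big1 ?addr0 1?eq_sym // => u uv.
  by rewrite eq_sym (negbTE uv) mul0r.
have -> : \sum_u (-1) ^+ (kerdock a u (+) pairing v u) / r *
      ((-1) ^+ (kerdock a u (+) pairing v' u) / r) =
    (\sum_u (-1) ^+ (pairing v u (+) pairing v' u)) / r ^+ 2.
  rewrite mulr_suml; apply: eq_bigr => u _.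
  rewrite mulrACA -signr_addb -invfM -expr2.
  by rewrite addbACA addbb.
by rewrite pairing_orth natrM -sqr_root_card mulrAC divff ?mul1r //
  expf_neq0 // root_card_neq0.
Qed.

(** Completeness of each basis; summed over all bases it makes the whole collection a tight
    frame. *)
Lemma mub_complete (b : option F) (u u' : F * bool) :
  \sum_v mub b v u * mub b v u' = (u == u')%:R.
Proof.
case: b => [a|] /=; last first.
  rewrite (bigD1 u) //= eqxx mul1r big1 ?addr0 // => v vu.
  by rewrite (negbTE vu) mul0r.
have -> : \sum_v (-1) ^+ (kerdock a u (+) pairing v u) / r *
      ((-1) ^+ (kerdock a u' (+) pairing v u') / r) =
    (-1) ^+ (kerdock a u (+) kerdock a u') *
      ((\sum_v (-1) ^+ (pairing u v (+) pairing u' v)) / r ^+ 2).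
  rewrite mulr_suml mulr_sumr; apply: eq_bigr => v _.
  rewrite mulrACA -signr_addb -invfM -expr2 mulrA -signr_addb.
  by rewrite addbACA !(pairingC v).
rewrite pairing_orth natrM -sqr_root_card mulrAC divff ?mul1r ?expf_neq0
  ?root_card_neq0 //.
by case: eqVneq => [->|_]; rewrite ?mulr0 // addbb mulr1.
Qed.

(** For two Kerdock bases the inner product is a Gauss sum for [kerdock a + kerdock a'] plus a
    linear term, of absolute value [r], divided by [r ^+ 2]. Against the standard basis it is a
    single entry of absolute value [1 / r]. *)
Lemma mub_unbiased (b b' : option F) (v v' : F * bool) :
  b != b' -> r * `|\sum_u mub b v u * mub b' v' u| = 1.
Proof.
have r0 : 0 < r by rewrite lt0r root_card_neq0 ler0n.
have sgn c d w w' : r * `|\sum_u mub None w u * mub (Some c) w' u| = 1 /\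
    r * `|\sum_u mub (Some c) w' u * mub d w u| =
    r * `|\sum_u mub d w u * mub (Some c) w' u|.
  split; last by congr (_ * `|_|); apply: eq_bigr => u _; rewrite mulrC.
  rewrite (bigD1 w) //= eqxx mul1r big1 ?addr0 => [|u uw]; last first.
    by rewrite eq_sym (negbTE uw) mul0r.
  by rewrite normrM normr_sign mul1r gtr0_norm ?invr_gt0 // divff ?gt_eqF.
case: b b' => [a|] [a'|] // ab; last exact: (sgn a' None v v').1.
  pose g u := kerdock a u (+) kerdock a' u (+) pairing (vadd v v') u.
  pose B u w := kform a u w (+) kform a' u w.
  have gE : \sum_u mub (Some a) v u * mub (Some a') v' u =
      (\sum_u (-1) ^+ g u) / r ^+ 2.
    rewrite mulr_suml; apply: eq_bigr => u _ /=.
    rewrite mulrACA -signr_addb -invfM -expr2 /g pairingDl.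
    by rewrite addbACA.
  have gs : (\sum_u (-1) ^+ g u) ^+ 2 = r ^+ 2.
    rewrite sqr_root_card; apply: (@gauss_sum_sqr g B) => [u w|u z w|w w0].
    - rewrite /g /B !kerdockD pairingDr.
      by do 4!case: (kerdock _ _); do 2!case: (kform _ _ _);
        do 2!case: (pairing _ _).
    - by rewrite /B !kformDl addbACA.
    - exact: kform_nondeg w0.
  have : `|\sum_u (-1) ^+ g u| = r.
    apply/eqP; rewrite -(eqrXn2 (n := 2)) ?normr_ge0 ?ltW //.
    by rewrite real_normK ?num_real // gs.
  rewrite gE normrM => ->; rewrite gtr0_norm ?invr_gt0 ?exprn_gt0 //.
  by rewrite mulrA -expr2 divff // expf_neq0 // gt_eqF.
by rewrite (sgn a None v' v).2; exact: (sgn a None v' v).1.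
Qed.

(** * The Gram matrix obtained from repeated bases *)

Lemma sum_enum_val (T : finType) (f : T -> R) :
  \sum_(i < #|T|) f (enum_val i) = \sum_(x : T) f x.
Proof. by rewrite -(big_enum_val (fun x => f x)); apply: eq_bigl. Qed.


(** An index in [T] names a basis, a vector of it, and one of its [t] copies. In [frame_gram], [E]
    marks pairs of copies of the same vector. *)
Lemma mub_gram (t : nat) (D := (r ^+ 3 / 2 + 1) * t%:R - 1)
    (T : finType := (option F * (F * bool) * 'I_t)%type) : (0 < t)%N ->
  exists X : 'M[R]_(#|T|, #|T| - #|{: F * bool}|),
    (forall i, (X *m X^T) i i = 1) /\
    forall i j, i != j -> `|(X *m X^T) i j| <= D^-1.
Proof.
move=> t0; pose K := #|{: F * bool}|.
pose vec (i : 'I_#|T|) := mub (enum_val i).1.1 (enum_val i).1.2.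
pose W : 'M[R]_(#|T|, K) := \matrix_(i, j) vec i (enum_val j).
pose E : 'M[R]_#|T| :=
  \matrix_(i, j) ((enum_val i).1 == (enum_val j).1)%:R.
have sumT (f : option F * (F * bool) -> R) :
    \sum_(i < #|T|) f (enum_val i).1 = t%:R * \sum_x f x.
  rewrite (sum_enum_val (fun x : T => f x.1)).
  rewrite -(pair_bigA _ (fun x _ => f x)) /= mulr_sumr.
  by apply: eq_bigr => x _; rewrite sumr_const card_ord mulr_natl.
have cardFR : #|F|%:R = r ^+ 2 / 2.
  by rewrite sqr_root_card card_prod card_bool natrM mulfK ?pnatr_eq0.
have cardT : #|T|%:R = (r ^+ 2 / 2 + 1) * r ^+ 2 * t%:R :> R.
  rewrite !card_prod card_option card_ord !natrM -natrM -card_prod.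
  by rewrite -sqr_root_card -natr1 cardFR.
have K0 : (0 < K)%N by rewrite -(ltr0n R) -sqr_root_card lt0r sqr_ge0
  expf_neq0 // root_card_neq0.
have r0 : r != 0 := root_card_neq0.
have r2 : 2 <= r by rewrite /r expnS natrM ler_peMr // ler1n expn_gt0.
have tR : 1 <= t%:R :> R by rewrite ler1n.
have T0 : (0 < #|T|)%N.
  by rewrite -(ltr0n R) cardT !mulr_gt0 ?exprn_gt0 //; nra.
(* The ratio [#|T| / K] is [(r^2 / 2 + 1) t], and the terms linear in [r] cancel. *)
have DE : r * #|T|%:R / K%:R - (r - 1) * t%:R - 1 = D.
  by rewrite -sqr_root_card cardT /D; field.
have D0 : 0 < D.
  rewrite /D subr_gt0; have : 1 < r ^+ 3 / 2 + 1 by nra.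
  by nra.
have WWT i j : (W *m W^T) i j = \sum_u vec i u * vec j u.
  rewrite mxE -(sum_enum_val (fun u => vec i u * vec j u)).
  by apply: eq_bigr => l _; rewrite !mxE.
have WW i j : (W *m W^T) i j =
    \sum_u mub (enum_val i).1.1 (enum_val i).1.2 u
      * mub (enum_val j).1.1 (enum_val j).1.2 u by rewrite WWT.
rewrite -/K -DE; apply: (@frame_gram R #|T| K r t%:R W E) => //.
- by lra.
- by lra.
- by rewrite DE.
- apply/matrixP => i j; rewrite !mxE.
  under eq_bigr do rewrite !mxE.
  rewrite (sumT (fun x => mub x.1 x.2 (enum_val i) * mub x.1 x.2 (enum_val j))).
  rewrite -(pair_bigA _
    (fun b v => mub b v (enum_val i) * mub b v (enum_val j))).
  under eq_bigr do rewrite mub_complete.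
  rewrite sumr_const card_option (inj_eq enum_val_inj) -(mulr_natr _ #|F|.+1).
  rewrite -natr1 cardFR -[RHS]mulr_natr cardT /K -sqr_root_card.
  by move: (_ == _)%:R => x; field.
- by apply/matrixP => i j; rewrite !mxE eq_sym.
- apply/matrixP => i j; rewrite !mxE.
  under eq_bigr do rewrite !mxE.
  rewrite (sumT (fun x => ((enum_val i).1 == x)%:R * (x == (enum_val j).1)%:R)).
  congr (_ * _); rewrite (bigD1 (enum_val i).1) //= eqxx mul1r big1 ?addr0 //.
  by move=> x xi; rewrite eq_sym (negbTE xi) mul0r.
- apply/matrixP => i j; rewrite !mxE.
  under eq_bigr do rewrite !mxE.
  rewrite (sumT (fun x => ((enum_val i).1 == x)%:R * mub x.1 x.2 (enum_val j))).
  congr (_ * _); rewrite (bigD1 (enum_val i).1) //= eqxx mul1r big1 ?addr0 //.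
  by move=> x xi; rewrite eq_sym (negbTE xi) mul0r.
- by move=> i; rewrite WW mub_orth eqxx.
- by move=> i; rewrite mxE eqxx.
move=> i j ij; rewrite WW mxE.
case: (enum_val i).1 (enum_val j).1 => [b v] [b' v'] /=.
(* The entry is [r - (r - 1) = 1] for two copies of one vector, 0 for distinct vectors of one basis,
   and a sign across bases. *)
have [<-|bb] := eqVneq b b'.
  rewrite mub_orth xpair_eqE eqxx /=; case: (v == v') => /=.
    by rewrite !mulr1 subKr normr1.
  by rewrite !mulr0 subrr normr0.
rewrite xpair_eqE (negbTE bb) mulr0 subr0 normrM.
by rewrite gtr0_norm ?mub_unbiased //; lra.
Qed.

End BinaryTrace.

Lemma kerdock_gram (R : rcfType) (h t : nat) (q := (2 ^ h.+1)%N)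
    (n := ((2 ^ (2 * h).+1).+1 * q ^ 2 * t)%N) : (0 < t)%N ->
  exists X : 'M[R]_(n, n - q ^ 2), (forall i, (X *m X^T) i i = 1) /\
    forall i j, i != j ->
      `|(X *m X^T) i j| <= ((q%:R ^+ 3 / 2 + 1) * t%:R - 1)^-1.
Proof.
move=> t0; have [F charF cardF] := @pPrimePowerField 2 (2 * h).+1 isT isT.
have cV : #|{: F * bool}| = (q ^ 2)%N.
  rewrite card_prod card_bool cardF /q -expnM -expnSr.
  by congr expn; lia.
have := @mub_gram F h charF cardF R t t0.
by rewrite /n -cV !card_prod card_option card_ord cardF.
Qed.

(** The regular simplex, needed for [k = 1]. It is [frame_gram] with [q = 1], [K = 1] and [W] the
    all-ones column. *)
Lemma simplex_gram (R : rcfType) (d : nat) : (0 < d)%N ->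
  exists X : 'M[R]_(d.+1, d), (forall i, (X *m X^T) i i = 1) /\
    forall i j, i != j -> `|(X *m X^T) i j| <= d%:R^-1.
Proof.
move=> d0.
have dR : 1 * d.+1%:R / 1%:R - (1 - 1) * d.+1%:R - 1 = d%:R :> R.
  by rewrite divr1 subrr mul0r subr0 mul1r -natr1 addrK.
have := @frame_gram R d.+1 1 1 d.+1%:R (const_mx 1) (const_mx 1).
rewrite dR subSS subn0; apply=> //.
- by rewrite ltr0n.
- apply/matrixP => i j; rewrite !mxE !ord1 eqxx.
  under eq_bigr do rewrite !mxE mulr1.
  by rewrite sumr_const card_ord divr1.
- by rewrite trmx_const.
- apply/matrixP => i j; rewrite !mxE.
  under eq_bigr do rewrite !mxE mulr1.
  by rewrite sumr_const card_ord mulr1.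
- apply/matrixP => i j; rewrite !mxE.
  under eq_bigr do rewrite !mxE mulr1.
  by rewrite sumr_const card_ord mulr1.
- by move=> i; rewrite !mxE big_ord1 !mxE mulr1.
- by move=> i; rewrite mxE.
by move=> i j _; rewrite !mxE big_ord1 !mxE subrr mul0r subr0 !mul1r normr1.
Qed.

(** * Configurations of vectors and their extension to larger dimensions *)

Definition realizable (R : realType) (n d : nat) (c : R) : Prop :=
  exists2 x : 'I_n -> 'rV[R]_d, unit_family x &
    forall i j, i != j -> `|dot (x i) (x j)| <= c.

Lemma theta_le (R : realType) (d k : nat) (c : R) :
  (0 < d)%N -> 0 <= c -> realizable (d + k) d c -> theta R d k <= c.
Proof.
move=> d0 c0 [x xu xc]; apply: le_trans ((theta_min R k d0).2 _ xu) _.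
by apply: bigmax_le => // p; exact: xc.
Qed.

Lemma gram_realizable (R : realType) (n d : nat) (c : R) (X : 'M[R]_(n, d)) :
  (forall i, (X *m X^T) i i = 1) ->
  (forall i j, i != j -> `|(X *m X^T) i j| <= c) -> realizable n d c.
Proof.
move=> X1 Xc; have XE i j : dot (row i X) (row j X) = (X *m X^T) i j.
  by rewrite mxE; apply: eq_bigr => l _; rewrite !mxE.
exists (fun i => row i X) => [i|i j ij]; first by rewrite XE.
by rewrite XE Xc.
Qed.

Lemma realizable_dim (R : realType) (n d : nat) (c : R) :
  realizable n d c -> realizable n d.+1 c.
Proof.
move=> [x xu xc]; pose y i : 'rV[R]_(1 + d) := row_mx 0 (x i).
have yE i j : dot (y i) (y j) = dot (x i) (x j).
  rewrite /dot big_split_ord /= big1 ?add0r => [|l _]; last first.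
    by rewrite row_mxEl mxE mul0r.
  by apply: eq_bigr => l _; rewrite !row_mxEr.
by exists y => [i|i j ij]; rewrite yE; [exact: xu|exact: xc].
Qed.

(** The extra vector points along the new coordinate, where all the old ones vanish. *)
Lemma realizable_orthogonal (R : realType) (n d : nat) (c : R) :
  0 <= c -> realizable n d c -> realizable n.+1 d.+1 c.
Proof.
move=> c0 [x xu xc].
pose y (i : 'I_n.+1) : 'rV[R]_(1 + d) :=
  if unlift ord0 i is Some j then row_mx 0 (x j) else row_mx 1 0.
have dotE u v (a b : 'rV[R]_1) : dot (row_mx a u) (row_mx b v : 'rV_(1 + d)) =
    a ord0 ord0 * b ord0 ord0 + dot u v.
  rewrite /dot big_split_ord /= big_ord1 !row_mxEl; congr (_ + _).
  by apply: eq_bigr => l _; rewrite !row_mxEr.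
have d0l u : dot (0 : 'rV[R]_d) u = 0.
  by rewrite /dot big1 // => l _; rewrite mxE mul0r.
have d0r u : dot u (0 : 'rV[R]_d) = 0.
  by rewrite /dot big1 // => l _; rewrite mxE mulr0.
exists y => [i|i j].
  rewrite /y; case: unliftP => [i'|] _; rewrite dotE !mxE ?mul0r ?add0r //.
  by rewrite d0l mulr1 addr0.
rewrite /y; case: unliftP => [i'|] ->; case: unliftP => [j'|] -> ij;
  rewrite dotE !mxE /= ?(mul0r, mulr0) ?add0r ?d0l ?d0r ?normr0 //.
by apply: xc; apply: contraNneq ij => ->.
Qed.

Lemma realizable_add (R : realType) (n d s u : nat) (c : R) :
  0 <= c -> realizable n d c -> realizable (s + n) (u + (s + d)) c.
Proof.
move=> c0 nd; elim: u => [|u]; last exact: realizable_dim.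
by elim: s => [|s] //; exact: realizable_orthogonal.
Qed.

(** * Numerical estimate for the Kerdock configuration *)

Lemma kerdock_bound (R : realType) (q t d : R) : 2 <= q -> 1 <= t -> 0 < d ->
  d + q ^+ 2 = (q ^+ 2 / 2 + 1) * q ^+ 2 * t ->
  ((q ^+ 3 / 2 + 1) * t - 1)^-1 <= Num.sqrt (q ^+ 2 + 4 - q^-1) / d.
Proof.
move=> q2 t1 d0 dE; set D := _ - 1.
have q0 : 0 < q by lra.
have D0 : 0 < D.
  have : 1 < q ^+ 3 / 2 + 1 by rewrite ltrDr divr_gt0 // exprn_gt0.
  by rewrite /D; nra.
(* This is the limit of [d / D] for large [t]. Since [s <= q^2], in fact [d <= s D] for every
   [t]. *)
pose s := q ^+ 2 * (q ^+ 2 + 2) / (q ^+ 3 + 2).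
have c0 : 0 < q ^+ 3 + 2 by rewrite addr_gt0 // exprn_gt0.
have s0 : 0 <= s by rewrite divr_ge0 ?(ltW c0) // mulr_ge0 ?addr_ge0 ?sqr_ge0.
have sq : s <= q ^+ 2.
  rewrite /s ler_pdivrMr // ler_pM2l ?exprn_gt0 // lerD2r.
  by rewrite ler_eXn2l //; lra.
have dD : d <= s * D.
  have -> : d = s * D + (s - q ^+ 2).
    apply: (addIr (q ^+ 2)); rewrite dE /s /D; field; exact: lt0r_neq0.
  by rewrite gerDl subr_le0.
(* For large [q], [s^2] expands as [q^2 + 4 - 4/q + ...], so subtracting only [1/q] leaves a
   margin. *)
have sb : s ^+ 2 <= q ^+ 2 + 4 - q^-1.
  rewrite /s expr_div_n ler_pdivrMr ?exprn_gt0 // -subr_ge0.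
  have -> : (q ^+ 2 + 4 - q^-1) * (q ^+ 3 + 2) ^+ 2
      - (q ^+ 2 * (q ^+ 2 + 2)) ^+ 2
    = q ^+ 4 * (3 * q - 4) + 16 * q ^+ 3 + (16 - 4 * q^-1).
    by field; exact: lt0r_neq0.
  have : q^-1 <= 1 by rewrite invf_le1 //; lra.
  have : 0 <= q ^+ 4 * (3 * q - 4) by rewrite mulr_ge0 ?exprn_ge0 //; lra.
  have : 0 <= q ^+ 3 by rewrite exprn_ge0 // ltW.
  by lra.
have ss : s <= Num.sqrt (q ^+ 2 + 4 - q^-1).
  by rewrite -[leLHS]ger0_norm // -sqrtr_sqr ler_wsqrtr.
rewrite ler_pdivlMr // mulrC ler_pdivrMr //.
by apply: le_trans dD _; rewrite ler_pM2r.
Qed.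

Lemma kerdock_realizable (R : realType) (h t d : nat) (q := (2 ^ h.+1)%N) :
  (0 < d)%N -> (d + q ^ 2 = (2 ^ (2 * h).+1).+1 * q ^ 2 * t)%N ->
  realizable (d + q ^ 2) d
    (Num.sqrt (q%:R ^+ 2 + 4 - q%:R^-1) / d%:R : R).
Proof.
move=> d0 dE; have t0 : (0 < t)%N.
  case: t dE => // /eqP; rewrite muln0 addn_eq0 => /andP[/eqP d00].
  by rewrite d00 in d0.
have [X [X1 Xe]] := @kerdock_gram R h t t0.
have -> : (d + q ^ 2)%N = ((2 ^ (2 * h).+1).+1 * q ^ 2 * t)%N by [].
have dn : ((2 ^ (2 * h).+1).+1 * q ^ 2 * t - q ^ 2)%N = d by rewrite -dE addnK.
move: X X1 Xe; rewrite -/q dn => X X1 Xe; apply: (gram_realizable X1) => i j ij.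
apply: le_trans (Xe _ _ ij) _; apply: kerdock_bound.
- by rewrite /q expnS natrM ler_peMr // ler1n expn_gt0.
- by rewrite ler1n.
- by rewrite ltr0n.
rewrite -natrX -natrD dE 2!natrM -natr1; congr ((_ + 1) * _ * _).
apply: (mulIf (x := 2)) => //; rewrite divfK // -natrM -expnSr /q -expnM.
by congr (_%:R); congr expn; lia.
Qed.

(** * Both upper bounds on [theta] *)

Theorem theorem3p6 (R : realType) :
  (exists2 c : R, 0 < c &
     forall k d : nat, (exists m : nat, k = (4 ^ m)%N) -> (0 < d)%N ->
       congr_mod d%:R (- k%:R) (k%:R ^+ 2 / 2 + k%:R) ->
       theta R d k <=
         Num.sqrt (k%:R + 4 - c * k%:R `^ (- 2^-1)) / d%:R) /\
  (forall k : nat, (0 < k)%N ->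
     exists2 e : nat -> R, e n @[n --> \oo] --> (0 : R) &
       forall d : nat, (0 < d)%N ->
         theta R d k <= (1 + e d) * (2 * Num.sqrt (k%:R + 1) / d%:R)).
Proof.
split.
  (* The constant 1 suffices: for [k = q^2] the subtracted term is [1/q], and for [k = 1] the root
     is 2 while the simplex achieves [1/d]. *)
  exists 1 => // k d [[|h] ->] d0 cong.
    have sqrt1 : 1 <= Num.sqrt (4 : R).
      by rewrite -[leLHS]sqrtr1 ler_wsqrtr // ler1n.
    rewrite expn0 powR1 mul1r addrAC subrr add0r.
    apply: theta_le => //.
    have [X [X1 Xd]] := @simplex_gram R d d0.
    rewrite addn1; apply: (gram_realizable X1) => i j ij.
    by apply: le_trans (Xd _ _ ij) _; rewrite ler_pdivlMr ?ltr0n // mulVf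
      ?pnatr_eq0 -?lt0n.
  have kq : (4 ^ h.+1 = (2 ^ h.+1) ^ 2)%N by rewrite -expnM mulnC expnM.
  (* The modulus equals the number of vectors in all the bases, so the congruence makes [d + k] a
     multiple of it. *)
  have N : ((4 ^ h.+1) ^ 2 %/ 2 + 4 ^ h.+1 =
      (2 ^ (2 * h).+1).+1 * (2 ^ h.+1) ^ 2)%N.
    have -> : ((4 ^ h.+1) ^ 2 = 2 ^ (2 * h).+1 * (2 ^ h.+1) ^ 2 * 2)%N.
      by rewrite kq -!expnM -expnD -expnSr; congr expn; lia.
    by rewrite mulnK // kq mulSn addnC.
  have : ((4 ^ h.+1) ^ 2 %/ 2 + 4 ^ h.+1 %| d + 4 ^ h.+1)%N.
    by apply/congr_modP => //; rewrite oddX.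
  rewrite N kq => /dvdnP[t dt].
  have -> : (1 * ((2 ^ h.+1) ^ 2)%:R `^ (- 2^-1) : R) = (2 ^ h.+1)%:R^-1.
    by rewrite mul1r powRN powR12_sqrt // natrX sqrtr_sqr ger0_norm.
  apply: theta_le => //.
  rewrite natrX; apply: (@kerdock_realizable R h t d d0).
  by rewrite dt mulnC.
(* With this [h], [q^2] is the least power of 4 above [k]. *)
move=> k k0; pose h := trunc_log 4 k; pose q := (2 ^ h.+1)%N.
have q2 : (q ^ 2 = 4 ^ h.+1)%N by rewrite /q -expnM mulnC expnM.
have kq : (k < q ^ 2)%N by rewrite q2 trunc_log_ltn.
have qk : (q ^ 2 <= 4 * k)%N.
  by rewrite q2 expnS leq_mul2l trunc_logP.
pose N := ((2 ^ (2 * h).+1).+1 * q ^ 2)%N.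
have Nq : (q ^ 2 < N)%N.
  by rewrite /N ltn_Pmull ?expn_gt0 // ltnS expn_gt0.
pose S : R := 2 * Num.sqrt (k%:R + 1).
have S0 : 0 < S by rewrite mulr_gt0 // sqrtr_gt0 ltr_wpDl.
have bound d : (N + q ^ 2 < d)%N -> theta R d k <= S / (d - (N + q ^ 2))%:R.
  (* Here [N t] is the largest multiple of [N] up to [d + k]. To the [N t] vectors in dimension [d']
     one adds [d + k - N t] orthogonal vectors, then [q^2 - k] zero coordinates, reaching dimension
     [d]. *)
  move=> Nd; pose t := ((d + k) %/ N)%N; pose d' := (N * t - q ^ 2)%N.
  have N0 : (0 < N)%N by exact: leq_ltn_trans Nq.
  have dk : (d + k = N * t + (d + k) %% N)%N.
    by rewrite {1}(divn_eq (d + k) N) mulnC.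
  have rN : ((d + k) %% N < N)%N by rewrite ltn_mod.
  have d'E : (d' + q ^ 2 = N * t)%N by rewrite subnK //; lia.
  have d'0 : (0 < d')%N by lia.
  have d'd : (d - (N + q ^ 2) <= d')%N by lia.
  have b0 : 0 <= S / d'%:R by rewrite divr_ge0 // ltW.
  have : realizable (d' + q ^ 2) d' (S / d'%:R : R).
    have [x xu xc] := @kerdock_realizable R h t d' d'0 d'E.
    exists x => // i j ij; apply: le_trans (xc _ _ ij) _.
    rewrite ler_pM2r ?invr_gt0 ?ltr0n //.
    have -> : S = Num.sqrt (4 * (k%:R + 1)).
      rewrite sqrtrM // /S; congr (_ * _).
      by rewrite (_ : 4 = 2 ^+ 2) ?sqrtr_sqr ?ger0_norm // -natrX.
    apply: ler_wsqrtr; rewrite -natrX mulrDr mulr1.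
    have : (q ^ 2)%:R <= 4 * k%:R :> R by rewrite -natrM ler_nat.
    have : 0 <= (2 ^ h.+1)%:R^-1 :> R by rewrite invr_ge0.
    by rewrite /q; lra.
  move=> /(realizable_add (d + k - N * t) (q ^ 2 - k) b0).
  have -> : (d + k - N * t + (d' + q ^ 2) = d + k)%N by lia.
  have -> : (q ^ 2 - k + (d + k - N * t + d') = d)%N by lia.
  move=> dr; apply: le_trans (theta_le _ b0 dr) _; first by lia.
  by rewrite ler_pM2l // lef_pV2 ?posrE ?ltr0n ?ler_nat //; lia.
pose C := (N + q ^ 2)%N.
(* The error is the relative excess of [theta] over the target, so the inequality is immediate;
   truncation at 0 supplies the lower bound for the squeeze. *)
exists (fun d => Num.max 0 (theta R d k * d%:R / S - 1)); last first.
  move=> d d0; have dR : 0 < d%:R :> R by rewrite ltr0n.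
  rewrite -/S -ler_pdivrMr ?divr_gt0 // invf_div mulrA.
  by rewrite -lerBlDl le_max lexx orbT.
(* The excess is at most [n / (n - C) - 1 = C / (n - C)], and this is at most [4 C / (n + 1)] once
   [n > 2 C]. *)
apply: (@squeeze_cvgr _ _ _ _ (fun=> 0) (fun n => (4 * C)%:R * harmonic n)).
- near=> n; rewrite le_max lexx /= ge_max mulr_ge0 ?invr_ge0 //=.
  have nC : (2 * C < n)%N by near: n; exact: nbhs_infty_gt.
  have Cn : (C < n)%N by lia.
  have := bound n Cn; rewrite -/C natrB 1?ltnW // => th.
  have n1 : 1 <= n%:R :> R by rewrite ler1n; lia.
  have c0 : 0 <= C%:R :> R by [].
  have cn : 2 * C%:R < n%:R :> R by rewrite -natrM ltr_nat.
  rewrite /harmonic -natr1 natrM.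
  move: n%:R C%:R n1 c0 cn th => x c x1 c0 cx th.
  have xc : 0 < x - c by lra.
  have -> : 4 * c * (x + 1)^-1 = (1 + 4 * c / (x + 1)) - 1.
    by rewrite addrAC subrr add0r.
  rewrite lerB // ler_pdivrMr //.
  apply: (@le_trans _ _ (S / (x - c) * x)); first by rewrite ler_pM2r //; lra.
  rewrite -mulrA mulrC ler_pM2r // mulrC ler_pdivrMr //.
  have -> : (1 + 4 * c / (x + 1)) * (x - c) =
      x + c * (3 * x - 1 - 4 * c) / (x + 1).
    by field; rewrite gt_eqF //; lra.
  by rewrite lerDl divr_ge0 ?mulr_ge0 //; lra.
- exact: cvg_cst.
- rewrite -[X in _ --> X](mulr0 (4 * C)%:R).
  by apply: cvgM; [exact: cvg_cst | exact: cvg_harmonic].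
Unshelve. all: by end_near.
Qed.
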